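(* For any $\epsilon\in(0,1]$, any (possibly randomized) distributed algorithm in the $\mathsf{HYBRID}$ model that determines a $(2-\epsilon)$-approximation of the girth of a directed $n$-node graph with probability at least $2/3$ requires $\widetilde{\Omega}(n^{1/3})$ rounds.
   Context: Distributed setting: $n$ nodes with unique IDs in $\{1,\dots,n\}$; the input is a directed graph $G$ on these nodes, whose underlying undirected graph serves as the local communication graph; each node initially knows only its incident edges; synchronous rounds, unlimited local computation. In the $\mathsf{HYBRID}$ model, in every round each node may send a message of arbitrary size to each neighbor (local mode) and may additionally send and receive $\mathcal{O}(\log n)$-bit messages to/from up to $\mathcal{O}(\log n)$ arbitrary nodes (global mode); excess messages are dropped arbitrarily. The directed girth $g$ is the length of a shortest directed cycle; an $\alpha$-approximation algorithm returns $\widetilde g$ with $g\le\widetilde g\le\alpha g$. $\widetilde{\Omega}$ hides polylogarithmic factors in $n$. *)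

(* Defs.v *)
From HB Require Import structures.
From mathcomp Require Import all_boot all_order all_algebra.
From mathcomp Require Import boolp reals.
Set Implicit Arguments. Unset Strict Implicit. Unset Printing Implicit Defensive.
Import Order.TTheory GRing.Theory Num.Theory.

Definition loopless (n : nat) (G : rel 'I_n) : Prop := forall v, ~~ G v v.

Definition comm_adj (n : nat) (G : rel 'I_n) (u v : 'I_n) : bool :=
  (u != v) && (G u v || G v u).

Definition has_dcycle_len (n : nat) (G : rel 'I_n) (k : nat) : Prop :=
  exists p : seq 'I_n, size p = k /\ 0 < k /\ cycle G p.

(* Directed girth; None encodes "infinity" (G has no directed cycle). *)
Definition is_dgirth (n : nat) (G : rel 'I_n) (g : option nat) : Prop :=
  match g with
  | Some k => has_dcycle_len G k /\ (forall k', has_dcycle_len G k' -> k <= k')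
  | None => forall k, ~ has_dcycle_len G k
  end.

Definition approx_ok (R : realType) (eps : R) (g out : option nat) : Prop :=
  match g, out with
  | None, None => True
  | Some k, Some k' => (k <= k')%N /\ ((k'%:R : R) <= (2 - eps) * k%:R)%R
  | _, _ => False
  end.

(* Global messages: at most cap n K bits, each node sends at most      *)
(* cap n K global messages per round and receives at most cap n K;     *)
(* excess incoming global messages are dropped arbitrarily (by an      *)
(* adversarial drop policy).  cap n K = K * (floor(log2 n) + 1), i.e.  *)
(* O(log n) with constant K.                                           *)

Definition cap (n K : nat) : nat := K * (trunc_log 2 n).+1.

Definition bits := seq bool.

(* A T-round randomized algorithm for n nodes in the HYBRID model with
   constant K.  Each node v starts knowing its ID v, n, its incident
   edges (the function u |-> (G v u, G u v)) and its own private random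
   seed drawn uniformly from the finite nonempty type Om. *)
Record hybrid_alg (n K : nat) := HybridAlg {
  St : Type;
  Om : finType;
  Om_nonempty : 0 < #|Om|;
  LMsg : Type;                     (* local messages: arbitrary size *)
  init : 'I_n -> ('I_n -> bool * bool) -> Om -> St;
  (* local message sent in round r by node v (state s) to node u;
     only delivered if u is a neighbor of v in the communication graph *)
  local_out : nat -> 'I_n -> St -> 'I_n -> LMsg;
  (* global messages sent in round r: list of (destination, bits) *)
  global_out : nat -> 'I_n -> St -> seq ('I_n * bits);
  global_out_ok : forall r v s,
    (size (global_out r v s) <= cap n K)%N &&
    all (fun m => size m.2 <= cap n K)%N (global_out r v s);
  (* state update given received local messages (None: not a neighbor)
     and delivered global messages (sender, bits) *)
  update : nat -> 'I_n -> St -> ('I_n -> option LMsg) ->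
           seq ('I_n * bits) -> St;
  output : 'I_n -> St -> option nat  (* None = infinity *)
}.

Arguments St {n K} _.
Arguments Om {n K} _.
Arguments LMsg {n K} _.
Arguments init {n K} _ _ _ _.
Arguments local_out {n K} _ _ _ _ _.
Arguments global_out {n K} _ _ _ _.
Arguments update {n K} _ _ _ _ _ _.
Arguments output {n K} _ _ _.

(* Adversarial drop policy: given round, receiver and the list of all
   global messages addressed to it, keeps an arbitrary subsequence of
   exactly cap n K of them when there are more than cap n K. *)
Definition drop_policy (n : nat) := nat -> 'I_n -> seq ('I_n * bits) -> seq ('I_n * bits).

Definition drop_ok (n K : nat) (d : drop_policy n) : Prop :=
  forall r v l, (cap n K < size l)%N ->
    subseq (d r v l) l /\ size (d r v l) = cap n K.

Section Exec.
Variables (n K : nat) (A : hybrid_alg n K) (G : rel 'I_n) (d : drop_policy n)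
          (w : {ffun 'I_n -> Om A}).

Definition raw_global (r : nat) (s : 'I_n -> St A) (v : 'I_n) : seq ('I_n * bits) :=
  flatten [seq [seq (u, m.2) | m <- global_out A r u (s u) & m.1 == v]
          | u <- enum 'I_n].

Definition delivered (r : nat) (s : 'I_n -> St A) (v : 'I_n) : seq ('I_n * bits) :=
  let l := raw_global r s v in
  if (size l <= cap n K)%N then l else d r v l.

Definition step (r : nat) (s : 'I_n -> St A) : 'I_n -> St A :=
  fun v => update A r v (s v)
             (fun u => if comm_adj G u v then Some (local_out A r u (s u) v)
                       else None)
             (delivered r s v).

Fixpoint run (r : nat) : 'I_n -> St A :=
  match r with
  | 0 => fun v => init A v (fun u => (G v u, G u v)) (w v)
  | r'.+1 => step r' (run r')
  end.

End Exec.

Definition success (R : realType) (eps : R) (n K : nat) (A : hybrid_alg n K)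
    (T : nat) (G : rel 'I_n) (d : drop_policy n) (w : {ffun 'I_n -> Om A}) : Prop :=
  exists g, is_dgirth G g /\
    forall v, approx_ok eps g (output A v (@run n K A G d w T v)).

(* A is a T-round (2 - eps)-approximation algorithm succeeding with
   probability >= 2/3 on every loopless directed n-node graph, for every
   drop policy; probability over independent uniform seeds. *)
Definition correct (R : realType) (eps : R) (n K : nat) (A : hybrid_alg n K)
    (T : nat) : Prop :=
  forall (G : rel 'I_n), loopless G ->
  forall d : drop_policy n, drop_ok K d ->
    (2 * #|{ffun 'I_n -> Om A}| <=
     3 * #|[set w : {ffun 'I_n -> Om A} | `[< @success R eps n K A T G d w >] ]|)%N.

(* Main.v *)
Require Import Defs.
From HB Require Import structures.
From mathcomp Require Import all_boot all_order all_algebra.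
From mathcomp Require Import ring lra zify.
From mathcomp Require Import boolp reals sequences exp.
Set Implicit Arguments. Unset Strict Implicit. Unset Printing Implicit Defensive.
Import Order.TTheory GRing.Theory Num.Theory.
Local Open Scope ring_scope.

(** The girth problem is reduced to two-party set disjointness on [q * q] bits.
    Alice's input is a bipartite graph at the left end of [2 * q] paths of length
    [2 * T + 1], Bob's a bipartite graph at the right end, with half of the paths
    directed to the right and half to the left.  Every closed walk goes around the
    construction a whole number of times, and it can close after one turn exactly if
    the inputs intersect, so a ratio below 2 decides disjointness.  Within [T] rounds
    local communication cannot cross the paths, hence the global messages of the
    [O(q * T)] path nodes, [O(q * T ^ 2 * log ^ 2)] bits in total, form a transcript
    whose fibers are rectangles.

    The linear lower bound for disjointness compares the laws [P_ab] of the transcript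
    when a coordinate holds the bits [(a, b)].  By the rectangle property
    [P_00 * P_11 = P_01 * P_10] pointwise, so the Hellinger distance between [P_00] and
    [P_11] forces one between [P_00] and [P_01] or [P_10] in every coordinate, that is,
    a bias of the corresponding bit on the fibers.  The level-one inequality bounds the
    sum of the squared biases over all coordinates by a multiple of the number of bits
    of the transcript. *)

(** * Elementary bounds on the exponential *)

Section ExpBounds.
Variable R : realType.
Implicit Types x : R.

(** The tangent to the exponential at the mean [u] lies below it, and its linear term averages to
    zero. *)
Lemma expR_Jensen (J : finType) (Q : pred J) (p x : J -> R) :
  (forall j, Q j -> 0 <= p j) -> \sum_(j | Q j) p j = 1 ->
  expR (\sum_(j | Q j) p j * x j) <= \sum_(j | Q j) p j * expR (x j).
Proof.
move=> p_ge0 p1; set u := \sum_(j | Q j) p j * x j.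
have -> : expR u = \sum_(j | Q j) p j * (expR u * (1 + (x j - u))).
  rewrite (eq_bigr (fun j => expR u * (p j * x j) + expR u * (1 - u) * p j));
    last by move=> j _; ring.
  by rewrite big_split /= -!big_distrr /= -/u p1; ring.
apply: ler_sum => j Qj; apply: ler_wpM2l; first exact: p_ge0.
have -> : expR (x j) = expR u * expR (x j - u) by rewrite -expRD addrC subrK.
by apply: ler_wpM2l; [exact: expR_ge0 | exact: expR_ge1Dx].
Qed.

(** Since [expR (- x) >= 1 - x], it suffices that [(1 - x) * (1 + x + 2 * x ^+ 2) = 1 + x ^+ 2 * (1
    - 2 * x)] is at least 1. *)
Lemma expR_le_quadratic x : x <= 2^-1 -> expR x <= 1 + x + 2 * x ^+ 2.
Proof.
move=> xle; have h := expR_ge1Dx (- x).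
have e0 := expR_gt0 x; have q0 := sqr_ge0 x.
have : 1 <= (1 - x) * (1 + x + 2 * x ^+ 2).
  have : 0 <= x ^+ 2 * (1 - 2 * x) by apply: mulr_ge0 => //; lra.
  by nra.
have : expR x * expR (- x) = 1 by rewrite -expRD subrr expR0.
move: (expR x) (expR (- x)) h e0 => y z h e0 yz le1.
have y1 : y * (1 - x) <= 1 by nra.
have x1 : 0 < 1 - x by lra.
rewrite -(ler_pM2r x1); apply: le_trans y1 _.
by rewrite mulrC.
Qed.

Lemma sum_expR_opp_le x : `|x| <= 2^-1 ->
  expR x + expR (- x) <= 2 * expR (2 * x ^+ 2).
Proof.
rewrite ler_norml => /andP[x1 x2].
have h1 := expR_le_quadratic x2.
have h2 : expR (- x) <= 1 + - x + 2 * (- x) ^+ 2 by apply: expR_le_quadratic; lra.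
have h3 := expR_ge1Dx (2 * x ^+ 2).
rewrite sqrrN in h2; lra.
Qed.

Lemma exp2n_le_expR n : (2 ^ n)%N%:R <= expR (n%:R : R).
Proof.
rewrite natrX -[n%:R]mulr1 expRM_natl.
apply: lerXn2r; rewrite ?nnegrE ?expR_ge0 //.
by have := expR_ge1Dx (1 : R); lra.
Qed.

End ExpBounds.

(** * The level-one inequality for biases of bits *)

Section LevelOne.
Variables (R : realType) (I : finType).
Local Notation word := {ffun I -> bool}.
Implicit Types (A : {set word}) (i : I).

Definition bit_sign (b : bool) : R := if b then -1 else 1.

Definition sign_sum A i : R := \sum_(z in A) bit_sign (z i).

Definition bias A i : R := sign_sum A i / #|A|%:R.

Lemma bias_norm_le1 A i : `|bias A i| <= 1.
Proof.
rewrite /bias normrM normfV [`|#|A|%:R|]ger0_norm ?ler0n //.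
case: (posnP #|A|) => [->|A0]; first by rewrite invr0 mulr0 ler01.
rewrite ler_pdivrMr ?ltr0n // mul1r.
apply: le_trans (ler_norm_sum _ _ _) _.
rewrite -sum1_card natr_sum; apply: ler_sum => z _.
by case: (z i); rewrite /= ?normrN normr1.
Qed.

Lemma sum_words_prod (F : I -> bool -> R) :
  \sum_(z : word) \prod_i F i (z i) = \prod_i (F i true + F i false).
Proof.
rewrite -bigA_distr_bigA; apply: eq_bigr => i _.
by rewrite big_bool.
Qed.

(* Chernoff bound for the linear form with coefficients [bias A i]: its mean over [A] is [\sum_i (bias A i) ^+ 2], which a dense set cannot make large. *)
Lemma level_one A :
  #|A|%:R * expR ((\sum_i (bias A i) ^+ 2) / 8) <= (2 ^ #|I|)%N%:R.
Proof.
case: (posnP #|A|) => [->|A0]; first by rewrite mul0r ler0n.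
set s := \sum_i _; have Ar0 : (0 : R) < #|A|%:R by rewrite ltr0n.
(* Scaling by [1 / 4] keeps the coefficients within the range of [sum_expR_opp_le], and the mean
   [s / 4] beats the Chernoff exponent [2 * s / 16 = s / 8]. *)
pose u (z : word) : R := \sum_i bias A i / 4 * bit_sign (z i).
have mean : \sum_(z in A) #|A|%:R^-1 * u z = s / 4.
  rewrite -big_distrr /= /u exchange_big /= big_distrr /= /s big_distrl /=.
  apply: eq_bigr => i _; rewrite -big_distrr /= -/(sign_sum A i) /bias.
  by field; rewrite gt_eqF.
have jensen : #|A|%:R * expR (s / 4) <= \sum_(z in A) expR (u z).
  have w1 : \sum_(z in A) (#|A|%:R^-1 : R) = 1.
    by rewrite sumr_const -[LHS]mulr_natr mulVf ?gt_eqF.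
  have h := @expR_Jensen R _ (mem A) (fun=> #|A|%:R^-1) u _ w1.
  rewrite -mean mulrC -ler_pdivlMr // mulrC big_distrr /=; apply: h => _ _.
  by rewrite invr_ge0 ler0n.
have upper : \sum_(z in A) expR (u z) <= (2 ^ #|I|)%N%:R * expR (s / 8).
  apply: (@le_trans _ _ (\sum_z expR (u z))).
    by rewrite [leRHS](bigID (mem A)) /= lerDl sumr_ge0 // => z _; exact: expR_ge0.
  rewrite (eq_bigr (fun z : word => \prod_i expR (bias A i / 4 * bit_sign (z i))));
    last by move=> z _; rewrite expR_sum.
  rewrite (sum_words_prod (fun i b => expR (bias A i / 4 * bit_sign b))).
  have -> : (2 ^ #|I|)%N%:R * expR (s / 8) =
      \prod_i (2 * expR (2 * (bias A i / 4) ^+ 2)).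
    rewrite big_split /= prodr_const natrX; congr (_ * _).
    by rewrite /s big_distrl /= expR_sum; apply: eq_bigr => i _; congr expR; field.
  apply: ler_prod => i _; rewrite addr_ge0 ?expR_ge0 //=.
  rewrite mulr1 mulrN1 addrC; apply: sum_expR_opp_le.
  have := bias_norm_le1 A i; rewrite !ler_norml; lra.
have := le_trans jensen upper.
rewrite (_ : s / 4 = s / 8 + s / 8); last by field.
by rewrite expRD mulrA ler_pM2r // expR_gt0.
Qed.

(** Weight the fibers by their density: by Jensen and [level_one], the exponential of the mean of
    [s t / 8] is at most [#|M|], hence at most [expR C%:R]. *)
Lemma sum_bias_le (M : finType) (f : word -> M) (C : nat) :
  (#|M| <= 2 ^ C)%N ->
  \sum_i \sum_(t : M) #|[set z | f z == t]|%:R * (bias [set z | f z == t] i) ^+ 2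
    <= 8 * (2 ^ #|I|)%N%:R * C%:R :> R.
Proof.
move=> MC; pose B t := [set z | f z == t]; set V : R := (2 ^ #|I|)%N%:R.
have V0 : 0 < V by rewrite ltr0n expn_gt0.
pose s t : R := \sum_i (bias (B t) i) ^+ 2.
rewrite exchange_big /= (eq_bigr (fun t => #|B t|%:R * s t)); last first.
  by move=> t _; rewrite /s big_distrr.
have sumB : \sum_t #|B t|%:R / V = 1 :> R.
  rewrite -big_distrl /= -natr_sum.
  rewrite (_ : (\sum_t #|B t|)%N = (2 ^ #|I|)%N) ?divff ?gt_eqF //.
  rewrite -card_bool -card_ffun -sum1_card (partition_big f predT) //=.
  by apply: eq_bigr => t _; rewrite -sum1_card; apply: eq_bigl => z; rewrite inE.
have := @expR_Jensen R _ predT (fun t => #|B t|%:R / V) (fun t => s t / 8).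
move=> /(_ _ sumB) jensen.
have {jensen} : expR (\sum_t #|B t|%:R / V * (s t / 8)) <= expR C%:R.
  apply: le_trans (jensen _) _; first by move=> t _; rewrite divr_ge0 ?ler0n ?ltW.
  apply: (@le_trans _ _ (\sum_(t : M) 1)).
    apply: ler_sum => t _; rewrite mulrAC ler_pdivrMr // mul1r.
    exact: level_one.
  rewrite sumr_const; apply: le_trans (exp2n_le_expR _ _).
  by rewrite ler_nat.
rewrite ler_expR.
rewrite (eq_bigr (fun t => (8 * V)^-1 * (#|B t|%:R * s t))); last first.
  by move=> t _; field; rewrite gt_eqF.
by rewrite -big_distrr /= mulrC ler_pdivrMr ?mulr_gt0 // [leRHS]mulrC.
Qed.

End LevelOne.

(** * Hellinger distance and cut-and-paste *)

Section FourPoint.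
Variable R : rcfType.

Definition chi2 (a b : R) : R := (a - b) ^+ 2 / (a + b).

(** Factor [a - b] as a difference of squares of roots and use that the squared sum of the roots is
    at least [a + b]. If both vanish, [chi2] is 0 by the convention for division. *)
Lemma hellinger_le_chi2 (a b : R) : 0 <= a -> 0 <= b ->
  (Num.sqrt a - Num.sqrt b) ^+ 2 <= chi2 a b.
Proof.
move=> a0 b0; rewrite /chi2 -{2 3}(sqr_sqrtr a0) -{2 3}(sqr_sqrtr b0).
have := sqrtr_ge0 a; have := sqrtr_ge0 b.
move: (Num.sqrt a) (Num.sqrt b) => x y y0 x0.
have [|s0] := eqVneq (x ^+ 2 + y ^+ 2) 0.
  move/eqP; rewrite paddr_eq0 ?sqr_ge0 // !sqrf_eq0 => /andP[/eqP-> /eqP->].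
  by rewrite !subrr expr0n /= mul0r.
have sp : 0 < x ^+ 2 + y ^+ 2 by rewrite lt_def s0 addr_ge0 ?sqr_ge0.
rewrite ler_pdivlMr // subr_sqr exprMn; apply: ler_wpM2l; first exact: sqr_ge0.
by have := mulr_ge0 x0 y0; nra.
Qed.

(* The affinities of the pairs (P00, P11) and (P01, P10) agree, so the Hellinger distance from P00 to P11, forced by [acc], passes to P01 and P10 and hence to P00 and one of them. *)
Lemma four_point (J : finType) (acc : pred J) (S : R) (P : bool -> bool -> J -> R) :
  (forall a b j, 0 <= P a b j) ->
  (forall j, P false false j * P true true j = P false true j * P true false j) ->
  (forall a b, \sum_j P a b j = S) ->
  2 * S <= 3 * \sum_(j | acc j) P false false j ->
  3 * \sum_(j | acc j) P true true j <= S ->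
  S <= 36 * \sum_j (chi2 (P false false j) (P false true j) +
                    chi2 (P false false j) (P true false j)).
Proof.
move=> P0 cut sumP acc00 acc11.
pose r a b j := Num.sqrt (P a b j).
have rr a b j : r a b j ^+ 2 = P a b j by rewrite sqr_sqrtr.
have r0 a b j : 0 <= r a b j by exact: sqrtr_ge0.
have cutr j : r false false j * r true true j = r false true j * r true false j.
  by rewrite /r -!sqrtrM // cut.
have swap : \sum_j (r false false j - r true true j) ^+ 2 =
            \sum_j (r false true j - r true false j) ^+ 2.
  apply/eqP; rewrite -subr_eq0 -sumrB.
  rewrite (eq_bigr (fun j => P false false j + P true true j
                             - (P false true j + P true false j))); last first.
    by move=> j _; rewrite -!rr; have := cutr j; nra.
  by rewrite sumrB !big_split /= !sumP subrr.
(* Pointwise [(x - y) ^+ 2 >= x ^+ 2 / 3 - y ^+ 2 / 2]. With acceptance at least [2 * S / 3] and at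
   most [S / 3] this yields [S / 18]; the factor 2 in [up] then gives 36. *)
have low : 3^-1 * \sum_(j | acc j) P false false j
           - 2^-1 * \sum_(j | acc j) P true true j
           <= \sum_j (r false false j - r true true j) ^+ 2.
  rewrite !big_distrr /= -sumrB [leRHS](bigID acc) /= -[leLHS]addr0.
  apply: lerD; last by apply: sumr_ge0 => j _; exact: sqr_ge0.
  apply: ler_sum => j _; rewrite -!rr.
  have := sqr_ge0 (2 * r false false j - 3 * r true true j); nra.
have up : \sum_j (r false true j - r true false j) ^+ 2 <=
   2 * \sum_j (chi2 (P false false j) (P false true j) +
               chi2 (P false false j) (P true false j)).
  rewrite big_distrr /=; apply: ler_sum => j _.
  have := hellinger_le_chi2 (P0 false false j) (P0 true false j).
  have := hellinger_le_chi2 (P0 false false j) (P0 false true j).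
  have := sqr_ge0 (2 * r false false j - r false true j - r true false j).
  rewrite /r; move: (chi2 _ _) (chi2 _ _) => u v.
  by move: (Num.sqrt _) (Num.sqrt _) (Num.sqrt _) => x y z; nra.
lra.
Qed.

End FourPoint.

(** * Dealing the bits of a word to two players *)

Section Words.
Variable I : finType.
Local Notation word := {ffun I -> bool}.
Implicit Types (z D x y : word) (i : I).

Definition set_bit i (a : bool) z : word := [ffun j => if j == i then a else z j].

Definition flip_bit i z : word := set_bit i (~~ z i) z.

(** The mask [D] assigns each coordinate to one player; the other player sees 0 there, so the two
    parts are always disjoint inputs. *)
Definition left_part D z : word := [ffun j => z j && ~~ D j].

Definition right_part D z : word := [ffun j => z j && D j].

Definition splice D z z' : word := [ffun j => if D j then z' j else z j].

Lemma flip_bitK i : involutive (flip_bit i).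
Proof.
move=> z; apply/ffunP => j; rewrite !ffunE eqxx.
by case: eqP => [->|//]; rewrite negbK.
Qed.

Lemma flip_bit_at i z : flip_bit i z i = ~~ z i.
Proof. by rewrite ffunE eqxx. Qed.

Lemma set_bit_id i z : set_bit i (z i) z = z.
Proof. by apply/ffunP => j; rewrite !ffunE; case: eqP => // ->. Qed.

Lemma set_left_part_flip_mask i a D z :
  set_bit i a (left_part (flip_bit i D) z) = set_bit i a (left_part D z).
Proof. by apply/ffunP => j; rewrite !ffunE; case: eqP. Qed.

Lemma set_right_part_flip_mask i a D z :
  set_bit i a (right_part (flip_bit i D) z) = set_bit i a (right_part D z).
Proof. by apply/ffunP => j; rewrite !ffunE; case: eqP. Qed.

Lemma set_left_part_flip_word i a D z :
  set_bit i a (left_part D (flip_bit i z)) = set_bit i a (left_part D z).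
Proof. by apply/ffunP => j; rewrite !ffunE; case: eqP. Qed.

Lemma set_right_part_flip_word i a D z :
  set_bit i a (right_part D (flip_bit i z)) = set_bit i a (right_part D z).
Proof. by apply/ffunP => j; rewrite !ffunE; case: eqP. Qed.

Lemma left_part_splice D z z' : left_part D (splice D z z') = left_part D z.
Proof. by apply/ffunP => j; rewrite !ffunE; case: (D j); rewrite ?andbF. Qed.

Lemma right_part_splice D z z' : right_part D (splice D z z') = right_part D z'.
Proof. by apply/ffunP => j; rewrite !ffunE; case: (D j); rewrite ?andbF. Qed.

Lemma spliceK D :
  involutive (fun zz : word * word => (splice D zz.1 zz.2, splice D zz.2 zz.1)).
Proof.
by case=> z z'; congr pair; apply/ffunP => j; rewrite !ffunE; case: (D j).
Qed.

Lemma sum_flip_invariant (R : pzSemiRingType) i (b : bool) (g : word -> R) :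
  (forall z, g (flip_bit i z) = g z) ->
  \sum_z g z = 2 * \sum_(z : word | z i == b) g z.
Proof.
move=> gflip; rewrite (bigID (fun z : word => z i == b)) /= mulr_natl mulr2n.
congr (_ + _); rewrite (reindex_inj (inv_inj (flip_bitK i))).
apply: eq_big => [z|z _]; last exact: gflip.
by rewrite flip_bit_at; case: (z i); case: b.
Qed.

End Words.

(** * The linear lower bound for set disjointness *)

Section Disjointness.
Variables (R : realType) (I W M : finType).
Local Notation word := {ffun I -> bool}.
Variables (tau : W -> word -> word -> M) (acc : pred M) (C : nat).

Hypothesis rectangle : forall w x y x' y' t,
  tau w x y = t -> tau w x' y' = t -> tau w x y' = t.
Hypothesis W_gt0 : (0 < #|W|)%N.
Hypothesis M_le : (#|M| <= 2 ^ C)%N.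
Hypothesis acc_disjoint : forall x y : word, (forall i, ~~ (x i && y i)) ->
  (2 * #|W| <= 3 * #|[set w | acc (tau w x y)]|)%N.
Hypothesis acc_intersecting : forall (x y : word) i, x i -> y i ->
  (3 * #|[set w | acc (tau w x y)]| <= #|W|)%N.

(* Up to normalization, the law of the transcript when coordinate [i] holds the bits [a] and [b], and each other coordinate holds a uniform bit given to the player selected by [D]. *)
Definition law (D : word) i a b (j : W * M) : R :=
  \sum_(z : word)
    (tau j.1 (set_bit i a (left_part D z)) (set_bit i b (right_part D z)) == j.2)%:R.

Local Notation V := ((2 ^ #|I|)%N%:R : R).

Lemma card_words : #|{ffun I -> bool}| = (2 ^ #|I|)%N.
Proof. by rewrite card_ffun card_bool. Qed.

(** Exchanging the right parts of two words is an involution on pairs of words, and by the rectangle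
    property it preserves the event that both transcripts equal [j.2]. *)
Lemma law_cut_paste D i j :
  law D i false false j * law D i true true j =
  law D i false true j * law D i true false j.
Proof.
rewrite /law !big_distrlr /= !pair_big /=.
rewrite [RHS](reindex_inj (inv_inj (spliceK D))) /=.
apply: eq_bigr => -[z z'] _ /=.
rewrite !left_part_splice !right_part_splice -!natrM !mulnb; congr (nat_of_bool _)%:R.
by apply/andP/andP => -[/eqP h1 /eqP h2]; split; apply/eqP; apply: rectangle; eassumption.
Qed.

Lemma law_flip D i a b j : law (flip_bit i D) i a b j = law D i a b j.
Proof.
by apply: eq_bigr => z _; rewrite set_left_part_flip_mask set_right_part_flip_mask.
Qed.

Lemma sum_law (Q : pred M) D i a b :
  \sum_(j : W * M | Q j.2) law D i a b j =
  \sum_(z : word) #|[set w | Q (tau w (set_bit i a (left_part D z))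
                                      (set_bit i b (right_part D z)))]|%:R.
Proof.
rewrite exchange_big /=; apply: eq_bigr => z _.
rewrite -(pair_big predT Q (fun w t => ((tau w _ _ == t)%:R : R))) /=.
rewrite -sum1_card natr_sum [RHS]big_mkcond /=; apply: eq_bigr => w _.
rewrite inE; set t0 := tau _ _ _.
case: ifP => Qt.
  rewrite (bigD1 t0) //= eqxx big1 ?addr0 // => t /andP[_ /negPf].
  by rewrite eq_sym => ->.
rewrite big1 // => t Qt'; case: eqP => // tt.
by rewrite tt Qt' in Qt.
Qed.

Lemma sum_law_total D i a b : \sum_j law D i a b j = #|W|%:R * V.
Proof.
rewrite (sum_law predT) (eq_bigr (fun=> #|W|%:R)); last first.
  by move=> z _; rewrite (_ : [set w | _] = setT) ?cardsT //; apply/setP => w; rewrite !inE.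
by rewrite sumr_const card_words -[LHS]mulr_natr.
Qed.

(** Outside [i] the dealt inputs never meet, so the bits [(0, 0)] give disjoint inputs and [(1, 1)]
    intersecting ones, which acceptance tells apart. *)
Lemma law_chi2_ge D i :
  #|W|%:R * V <= 36 * \sum_j (chi2 (law D i false false j) (law D i false true j) +
                       chi2 (law D i false false j) (law D i true false j)).
Proof.
apply: (@four_point _ _ (fun j => acc j.2) _ (law D i)).
- by move=> a b j; apply: sumr_ge0 => z _; rewrite ler0n.
- exact: law_cut_paste.
- exact: sum_law_total.
- rewrite sum_law big_distrr /= mulrA.
  rewrite (_ : 2 * #|W|%:R * V = \sum_(z : word) (2 * #|W|)%:R); last first.
    by rewrite sumr_const card_words -[RHS]mulr_natr natrM.
  apply: ler_sum => z _; rewrite -natrM ler_nat; apply: acc_disjoint => k.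
  by rewrite !ffunE; case: eqP => //= _; case: (D k); rewrite ?andbF.
- rewrite sum_law big_distrr /=.
  rewrite (_ : #|W|%:R * V = \sum_(z : word) #|W|%:R); last first.
    by rewrite sumr_const card_words -[RHS]mulr_natr.
  apply: ler_sum => z _; rewrite -natrM ler_nat; apply: (@acc_intersecting _ _ i).
    by rewrite ffunE eqxx.
  by rewrite ffunE eqxx.
Qed.

Definition split_transcript w (D z : word) : M := tau w (left_part D z) (right_part D z).

Definition fiber w D t : {set word} := [set z | split_transcript w D z == t].

(** Giving the bit [b] to the owner of [i] reproduces the dealt word when [z i = b]; the factor 2
    accounts for the overwritten bit [z i]. *)
Lemma law_free_bit D i w t b :
  law D i (b && ~~ D i) (b && D i) (w, t) =
  2 * #|[set z in fiber w D t | z i == b]|%:R.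
Proof.
rewrite /law (@sum_flip_invariant _ _ i b) /=; last first.
  by move=> z; rewrite set_left_part_flip_word set_right_part_flip_word.
congr (_ * _); rewrite -sum1_card natr_sum.
rewrite [RHS](eq_bigl (fun z : word => (z i == b) && (z \in fiber w D t))); last first.
  by move=> z; rewrite inE andbC.
rewrite [RHS]big_mkcondr /=; apply: eq_bigr => z /eqP zb.
rewrite inE /split_transcript.
have -> : b && ~~ D i = left_part D z i by rewrite ffunE zb.
have -> : b && D i = right_part D z i by rewrite ffunE zb.
by rewrite !set_bit_id; case: (_ == _).
Qed.

(** The bit 1 goes to the player whom [D] makes the owner of [i], so this law can be read off the
    fibers of [split_transcript]. *)
Definition free_law (D : word) i j : R :=
  if D i then law D i false true j else law D i true false j.

Lemma chi2_free_law D i w t :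
  chi2 (law D i false false (w, t)) (free_law D i (w, t)) =
  2 * (#|fiber w D t|%:R * (bias R (fiber w D t) i) ^+ 2).
Proof.
have -> : free_law D i (w, t) = law D i (true && ~~ D i) (true && D i) (w, t).
  by rewrite /free_law; case: (D i).
have -> : law D i false false (w, t) = law D i (false && ~~ D i) (false && D i) (w, t).
  by [].
rewrite !law_free_bit; set A := fiber w D t.
set N0 := [set z in A | z i == false]; set N1 := [set z in A | z i == true].
have cardA : #|A|%:R = #|N0|%:R + #|N1|%:R :> R.
  rewrite -natrD; congr (_%:R); rewrite -!sum1_card (bigID (fun z : word => z i == false)) /=.
  by congr addn; apply: eq_bigl => z; rewrite !inE //; case: (z i).
have signA : sign_sum R A i = #|N0|%:R - #|N1|%:R.
  rewrite /sign_sum (bigID (fun z : word => z i == false)) /= -!sum1_card !natr_sum -sumrN.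
  congr (_ + _).
    by apply: eq_big => [z|z /andP[_ /eqP->]] //; rewrite !inE.
  apply: eq_big => [z|z /andP[_]]; first by rewrite !inE; case: (z i).
  by case: (z i).
rewrite /chi2 /bias signA cardA.
have [s0|s0] := eqVneq (#|N0|%:R + #|N1|%:R : R) 0.
  by rewrite -mulrDr s0 mulr0 invr0 mulr0 mul0r mulr0.
move: (#|N0|%:R : R) (#|N1|%:R : R) s0 => u v s0. 
by field; rewrite s0 -mulrDr mulf_neq0 ?pnatr_eq0.
Qed.

Lemma sum_chi2_free_law D :
  \sum_i \sum_j chi2 (law D i false false j) (free_law D i j) <= 16 * V * C%:R * #|W|%:R.
Proof.
under eq_bigr => i _.
  rewrite -(pair_bigA _ (fun w t => chi2 (law D i false false (w, t)) (free_law D i (w, t)))) /=.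
  over.
rewrite exchange_big /= mulr_natr -sumr_const; apply: ler_sum => w _.
under eq_bigr => i _ do under eq_bigr => t _ do rewrite chi2_free_law.
have := @sum_bias_le R I M (split_transcript w D) C M_le; rewrite -/(fiber w D _).
under eq_bigr => i _ do rewrite -big_distrr /=.
rewrite -big_distrr /= => h.
rewrite (_ : 16 * V * C%:R = 2 * (8 * V * C%:R)); last by ring.
by rewrite ler_pM2l.
Qed.

Lemma disjointness_lower_bound : (#|I| <= 1152 * C)%N.
Proof.
pose c01 D i j := chi2 (law D i false false j) (law D i false true j).
pose c10 D i j := chi2 (law D i false false j) (law D i true false j).
have V0 : 0 < V by rewrite ltr0n expn_gt0.
have W0 : 0 < (#|W|%:R : R) by rewrite ltr0n.
(* The laws at [i] do not depend on [D i], so [c01] may be summed over masks with [D i] true and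
   [c10] over the others, each at the price of a factor 2. Overall [1152 = 36 * 2 * 16]. *)
have pair_up i : \sum_D (\sum_j (c01 D i j + c10 D i j)) =
    2 * \sum_D \sum_j chi2 (law D i false false j) (free_law D i j).
  under eq_bigr => D _ do rewrite big_split /=.
  rewrite big_split /= (@sum_flip_invariant _ _ i true) /=; last first.
    by move=> D; apply: eq_bigr => j _; rewrite /c01 !law_flip.
  rewrite (@sum_flip_invariant _ _ i false) /=; last first.
    by move=> D; apply: eq_bigr => j _; rewrite /c10 !law_flip.
  rewrite -mulrDr [in RHS](bigID (fun D : word => D i == true)) /=.
  congr (2 * (_ + _)).
    by apply: eq_bigr => D /eqP Di; rewrite /free_law Di.
  apply: eq_big => [D|D /eqP Di]; first by case: (D i).
  by rewrite /free_law Di.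
have lower : #|I|%:R * (V * (#|W|%:R * V)) <=
    36 * \sum_i \sum_D (\sum_j (c01 D i j + c10 D i j)).
  rewrite mulr_natl -sumr_const big_distrr /=; apply: ler_sum => i _.
  rewrite -card_words mulr_natl -sumr_const card_words big_distrr /=.
  by apply: ler_sum => D _; exact: law_chi2_ge.
have upper : \sum_i \sum_D (\sum_j (c01 D i j + c10 D i j)) <=
    2 * (V * (16 * V * C%:R * #|W|%:R)).
  under eq_bigr => i _ do rewrite pair_up.
  rewrite -big_distrr /= ler_pM2l // exchange_big /=.
  rewrite -card_words mulr_natl -sumr_const card_words.
  by apply: ler_sum => D _; exact: sum_chi2_free_law.
rewrite -(ler_nat R) natrM.
have VW : 0 < V * (#|W|%:R * V) by rewrite !mulr_gt0.
rewrite -(ler_pM2r VW); apply: le_trans lower _.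
rewrite (_ : 1152%:R * _ * _ = 36 * (2 * (V * (16 * V * C%:R * #|W|%:R)))).
  by rewrite ler_pM2l.
by ring.
Qed.

End Disjointness.

(** * Encoding short lists as tuples of fixed length *)

Section Padding.
Local Open Scope nat_scope.
Variable U : Type.

Definition pad m (s : seq U) : m.-tuple (option U) :=
  [tuple nth None (map Some s) i | i < m].

Definition unpad : seq (option U) -> seq U := pmap id.

Lemma padK m (s : seq U) : size s <= m -> unpad (pad m s) = s.
Proof.
move=> sm; have -> : pad m s = map Some s ++ nseq (m - size s) None :> seq _.
  apply: (@eq_from_nth _ None) => [|i].
    by rewrite size_tuple size_cat size_map size_nseq subnKC.
  rewrite size_tuple => im; rewrite -[i]/(nat_of_ord (Ordinal im)) -tnth_nth tnth_mktuple /=.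
  rewrite nth_cat size_map nth_nseq if_same; case: ltnP => // si.
  by rewrite nth_default // size_map.
rewrite /unpad pmap_cat (map_pK (g := Some)) //.
by elim: (m - size s) => [|k]; rewrite ?cats0.
Qed.

End Padding.

(** * Counting the global messages of a node in one round *)

Section Messages.
Local Open Scope nat_scope.
Variables n K : nat.

Definition message_code : finType :=
  (cap n K).-tuple (option ('I_n * (cap n K).-tuple (option bool))).

Definition encode_messages (l : seq ('I_n * bits)) : message_code :=
  pad (cap n K) [seq (a.1, pad (cap n K) a.2) | a <- l].

Lemma encode_messages_inj l l' :
  (size l <= cap n K) && all (fun a => size a.2 <= cap n K) l ->
  (size l' <= cap n K) && all (fun a => size a.2 <= cap n K) l' ->
  encode_messages l = encode_messages l' -> l = l'.
Proof.
pose dec (c : message_code) := [seq (a.1, unpad (tval a.2)) | a <- unpad c].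
have encK s : (size s <= cap n K) && all (fun a => size a.2 <= cap n K) s ->
    dec (encode_messages s) = s.
  case/andP=> size_s /allP all_s; rewrite /dec padK ?size_map // -map_comp.
  by apply: map_id_in => -[u b] /all_s /= hb; rewrite padK.
by move=> /encK hl /encK hl' e; rewrite -hl -hl' e.
Qed.

Lemma card_message_code :
  #|message_code| <= 2 ^ (K * K.*2.+1 * (trunc_log 2 n).+1 ^ 2).
Proof.
rewrite card_tuple card_option card_prod card_ord card_tuple card_option card_bool.
set l := (trunc_log 2 n).+1.
have n_lt : n < 2 ^ l by rewrite trunc_log_ltn.
have -> : K * K.*2.+1 * l ^ 2 = (l + 2 * cap n K) * cap n K.
  by rewrite /cap -/l -mul2n; ring.
have [->|c0] := posnP (cap n K); first by rewrite muln0.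
rewrite expnM leq_exp2r // expnD expnM.
(* One optional message has at most [n.+1 * 3 ^ cap n K] codes, and [n.+1 <= 2 ^ l],
   [3 <= 2 ^ 2]. *)
apply: (@leq_trans (n.+1 * 3 ^ cap n K)); first by rewrite mulSn addnC -addn1 leq_add2l expn_gt0.
by rewrite leq_mul // leq_exp2r.
Qed.

End Messages.

(** * Transcripts of HYBRID runs and their rectangle property *)

Section Simulation.
Local Open Scope nat_scope.
Variables (n K : nat) (A : hybrid_alg n K) (d : drop_policy n).
Variables (X Y : Type) (G : X -> Y -> rel 'I_n).
Variables (T L : nat) (pos : 'I_n -> nat) (E : {set 'I_n}).
Hypothesis TL : 2 * T < L.
Hypothesis G_left : forall x y y' u v,
  (pos u < L) || (pos v < L) -> G x y u v = G x y' u v.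
Hypothesis G_right : forall x x' y u v,
  (0 < pos u) || (0 < pos v) -> G x y u v = G x' y u v.
Hypothesis pos_adj : forall x y u v, comm_adj (G x y) u v -> pos u <= (pos v).+1.
Hypothesis pos_outside : forall u, u \notin E -> T <= pos u <= L - T.

Definition sent w x y r u : seq ('I_n * bits) :=
  global_out A r u (run (A := A) (G x y) d w r u).

Lemma delivered_ext r (s s' : 'I_n -> St A) v :
  (forall u, global_out A r u (s u) = global_out A r u (s' u)) ->
  delivered d r s v = delivered d r s' v.
Proof.
move=> ss'; rewrite /delivered (_ : raw_global r s v = raw_global r s' v) //.
by congr flatten; apply: eq_map => u; rewrite ss'.
Qed.

Lemma comm_adj_sym (H : rel 'I_n) u v : comm_adj H u v = comm_adj H v u.
Proof. by rewrite /comm_adj eq_sym orbC. Qed.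

(* In round [r] the run on [(x, y')] looks like the run on [(x, y)] at distance more than [r] from the right end, and like the run on [(x', y')] at distance more than [r] from the left end.  Since [2 * T < L] these two regions cover all nodes. *)
Lemma run_paste w x y x' y' :
  (forall r u, r < T -> u \in E -> sent w x y r u = sent w x' y' r u) ->
  forall r, r <= T ->
  (forall v, pos v < L - r ->
     run (A := A) (G x y') d w r v = run (A := A) (G x y) d w r v) /\
  (forall v, r < pos v ->
     run (A := A) (G x y') d w r v = run (A := A) (G x' y') d w r v) /\
  (forall r' u, r' < r ->
     sent w x y' r' u = sent w x y r' u /\ sent w x y' r' u = sent w x' y' r' u).
Proof.
move=> same; elim=> [_|r IH rT].
  split; last split => //.
    move=> v; rewrite subn0 => vL /=; congr init; apply: funext => u.
    by congr pair; apply: G_left; rewrite vL ?orbT.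
  move=> v v0 /=; congr init; apply: funext => u.
  by congr pair; apply: G_right; rewrite v0 ?orbT.
have [IHl [IHr IHs]] := IH (ltnW rT).
have sent_eq u : sent w x y' r u = sent w x y r u /\ sent w x y' r u = sent w x' y' r u.
  (* A node in [E] lies in one of the two regions, and the common transcript carries its message
     over to the other run. A node outside [E] lies in both regions. *)
  case: (boolP (u \in E)) => [uE|/pos_outside uE].
    have := same r u rT uE; case: (ltnP (pos u) (L - r)) => uL same_u.
      have e : sent w x y' r u = sent w x y r u by rewrite /sent IHl.
      by rewrite -same_u e.
    have e : sent w x y' r u = sent w x' y' r u by rewrite /sent IHr //; lia.
    by rewrite same_u e.
  by split; [rewrite /sent IHl | rewrite /sent IHr] => //; lia.
split; last split.
- move=> v vL /=; rewrite /step IHl; last by lia.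
  congr update; last by apply: delivered_ext => u; case: (sent_eq u).
  apply: funext => u.
  have <- : comm_adj (G x y') u v = comm_adj (G x y) u v.
    by rewrite /comm_adj !(@G_left x y' y) //; apply/orP; (left + right); lia.
  case: ifP => // /pos_adj uv; rewrite IHl //; lia.
- move=> v vL /=; rewrite /step IHr; last by lia.
  congr update; last by apply: delivered_ext => u; case: (sent_eq u).
  apply: funext => u.
  have <- : comm_adj (G x y') u v = comm_adj (G x' y') u v.
    by rewrite /comm_adj !(@G_right x x' y') //; apply/orP; (left + right); lia.
  case: ifP => //; rewrite comm_adj_sym => /pos_adj uv; rewrite IHr //; lia.
- move=> r' u; rewrite ltnS leq_eqVlt => /predU1P[->|]; [exact: sent_eq | exact: IHs].
Qed.

Variables (accept : pred (option nat)) (v0 : 'I_n).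
Hypothesis pos_v0 : pos v0 < L - T.

Definition accepts w x y := accept (output A v0 (run (A := A) (G x y) d w T v0)).

Definition transcript_type : finType :=
  ({ffun 'I_T * 'I_#|E| -> message_code n K} * bool)%type.

(** The acceptance bit is included so that the answer is a function of the transcript; it pastes
    because [v0] stays in the left region through round [T]. *)
Definition transcript w x y : transcript_type :=
  ([ffun j : 'I_T * 'I_#|E| => encode_messages K (sent w x y j.1 (enum_val j.2))],
   accepts w x y).

Lemma transcript_rectangle w x y x' y' t :
  transcript w x y = t -> transcript w x' y' = t -> transcript w x y' = t.
Proof.
move=> <- [/ffunP same_code same_acc].
have same r u : r < T -> u \in E -> sent w x y r u = sent w x' y' r u.
  move=> rT uE; have := same_code (Ordinal rT, enum_rank_in uE u).
  rewrite !ffunE /= enum_rankK_in // => /encode_messages_inj -> //;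
  exact: global_out_ok.
have [pl [_ ps]] := run_paste same (leqnn T).
congr pair; last by rewrite /accepts pl.
apply/ffunP => -[r j]; rewrite !ffunE /=.
by have [-> _] := ps r (enum_val j) (ltn_ord r).
Qed.

Lemma card_transcript :
  #|transcript_type| <= 2 ^ (K * K.*2.+1 * (trunc_log 2 n).+1 ^ 2 * (T * #|E|)).+1.
Proof.
rewrite card_prod card_bool card_ffun card_prod !card_ord expnS mulnC leq_mul2l /=.
rewrite [leqRHS]expnM; have [->//|c0] := posnP (T * #|E|).
by rewrite leq_exp2r // card_message_code.
Qed.

End Simulation.

(** * Cycles as periodic walks *)

Section CycleWalk.
Local Open Scope nat_scope.
Variables (U : Type) (e : rel U) (x0 : U).

Lemma cycle_nthP (c : seq U) :
  reflect (forall i, i < size c -> e (nth x0 c i) (nth x0 c (i.+1 %% size c))) (cycle e c).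
Proof.
case: c => [|x p]; first exact: ReflectT.
have eqn i : i < (size p).+1 ->
    nth x0 (rcons p x) i = nth x0 (x :: p) (i.+1 %% (size p).+1) /\
    nth x0 (x :: rcons p x) i = nth x0 (x :: p) i.
  rewrite ltnS leq_eqVlt => /predU1P[->|ip]; last first.
    rewrite modn_small ?ltnS //= nth_rcons ip; split=> //.
    by rewrite -rcons_cons nth_rcons /= ltnS ltnW.
  by rewrite modnn /= nth_rcons ltnn eqxx -rcons_cons nth_rcons /= ltnSn.
apply: (iffP (pathP x0)) => h i; rewrite ?size_rcons => ip.
  by have [<- <-] := eqn i ip; apply: h; rewrite size_rcons.
by have [-> ->] := eqn i ip; apply: h.
Qed.

Lemma cycle_walk (c : seq U) : cycle e c -> 0 < size c ->
  forall i, e (nth x0 c (i %% size c)) (nth x0 c (i.+1 %% size c)).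
Proof.
move=> /cycle_nthP cyc c0 i; have := cyc _ (ltn_pmod i c0).
by rewrite -addn1 modnDml addn1.
Qed.

End CycleWalk.

(** * The girth gadget and its cycles *)

Section GadgetGraph.
Local Open Scope nat_scope.
Variables (n q T : nat).
Hypothesis q_gt0 : 0 < q.

Local Notation L := (2 * T + 1).
Local Notation m := (4 * T + 4).

Local Notation word := {ffun 'I_q * 'I_q -> bool}.
Implicit Types (u v : 'I_n) (x y : word).

(** Node [s * q + j] with [j < q] is the node of track [j] in phase [s]; the nodes from phase [m] on
    are isolated padding. *)
Definition phase u : nat := u %/ q.

Definition track u : 'I_q := Ordinal (ltn_pmod u q_gt0).

(* The phases [0 .. L] run along the forward paths from the left to the right end, the phases [L + 1 .. m - 1] along the backward paths, so every edge advances the phase by one modulo [m]. *)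
Definition gadget x y : rel 'I_n := fun u v =>
  [&& phase u < m, phase v < m, phase v == (phase u).+1 %% m &
   if phase u == L then y (track u, track v)
   else if phase u == m.-1 then x (track v, track u) else track u == track v].

(* Distance from the left end; the isolated nodes are put in the middle. *)
Definition position u : nat :=
  if phase u < m then (if phase u <= L then phase u else m.-1 - phase u) else T.

Definition busy : {set 'I_n} := [set u | phase u < m].

Lemma gadget_loopless x y : loopless (gadget x y).
Proof. by move=> v; apply/negP => /and4P[h _ /eqP]; lia. Qed.

(** Bob's input affects only edges from phase [L] to phase [L + 1], and both phases have position
    [L]. *)
Lemma gadget_left x y y' u v :
  (position u < L) || (position v < L) -> gadget x y u v = gadget x y' u v.
Proof.
rewrite /gadget /position => h.
case: ltnP => //= hu; case: ltnP => //= hv; case: eqP => //= e.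
case: ifP => // /eqP eL; move: h; rewrite hu hv eL leqnn ltnn /= e eL.
rewrite modn_small; last by lia.
by case: ifP; lia.
Qed.

Lemma gadget_right x x' y u v :
  (0 < position u) || (0 < position v) -> gadget x y u v = gadget x' y u v.
Proof.
rewrite /gadget /position => h.
case: ltnP => //= hu; case: ltnP => //= hv; case: eqP => //= e.
case: ifP => // _; case: ifP => // /eqP em; exfalso; move: h; rewrite hu hv e em.
rewrite prednK ?modnn /=; last by lia.
by case: ifP; lia.
Qed.

Lemma next_phase s : s < m -> s.+1 %% m = if s == m.-1 then 0 else s.+1.
Proof.
move=> sm; case: eqP => [->|ne]; last by rewrite modn_small //; lia.
by rewrite prednK ?modnn //; lia.
Qed.

Lemma position_adj x y u v :
  comm_adj (gadget x y) u v -> position u <= (position v).+1.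
Proof.
rewrite /comm_adj /gadget /position => /andP[_ /orP[]] /and4P[h1 h2 /eqP h3 _];
  rewrite h1 h2; rewrite next_phase // in h3; move: h3; case: ifP; case: ifP;
  case: ifP; lia.
Qed.

Lemma position_outside u : u \notin busy -> T <= position u <= L - T.
Proof. by rewrite inE /position => /negPf ->; lia. Qed.

Hypothesis fits : q * m <= n.

Lemma card_busy : #|busy| <= q * m.
Proof.
have winj : injective (widen_ord fits) by move=> a b /(congr1 val) ?; apply: val_inj.
rewrite -[leqRHS]card_ord -(card_image winj).
apply: subset_leq_card; apply/subsetP => u; rewrite inE /phase ltn_divLR // mulnC => um.
by apply/imageP; exists (Ordinal um) => //; apply: val_inj.
Qed.

Lemma node_lt s (j : 'I_q) : s < m -> s * q + j < n.
Proof. by move=> sm; apply: leq_trans fits; have := ltn_ord j; nia. Qed.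

Lemma gadget_cycle x y p : x p -> y p -> has_dcycle_len (gadget x y) m.
Proof.
case: p => j i xp yp.
(* The common element [(j, i)] gives a forward track [j] and a backward track [i]; the two turns
   joining them are edges. *)
pose trk s := if s <= L then j else i.
have nz : 0 < n by apply: leq_trans fits; nia.
pose node s : 'I_n := insubd (Ordinal nz) (s * q + trk s).
have nodeE s : s < m -> node s = s * q + trk s :> nat.
  by move=> sm; rewrite val_insubd node_lt.
have phaseE s : s < m -> phase (node s) = s.
  by move=> sm; rewrite /phase nodeE // divnMDl // divn_small ?addn0.
have trackE s : s < m -> track (node s) = trk s.
  by move=> sm; apply: val_inj; rewrite /= nodeE // modnMDl modn_small.
exists (mkseq node m); rewrite size_mkseq; split=> //; split; first by lia.
apply/(cycle_nthP _ (Ordinal nz)) => s; rewrite size_mkseq => sm.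
have sm' : s.+1 %% m < m by rewrite ltn_pmod //; lia.
rewrite !nth_mkseq // /gadget !phaseE // sm sm' eqxx /= !trackE //.
case: eqP => [->|sL].
  rewrite modn_small; last by lia.
  by rewrite /trk leqnn ifF //; lia.
case: eqP => [->|sm1].
  rewrite prednK ?modnn; last by lia.
  by rewrite /trk leq0n ifF //; lia.
rewrite modn_small; last by lia.
rewrite /trk; have -> : (s.+1 <= L) = (s <= L) by lia.
exact: eqxx.
Qed.

Lemma gadget_walk_phase x y (f : nat -> 'I_n) :
  (forall i, gadget x y (f i) (f i.+1)) ->
  forall i, phase (f i) = (phase (f 0) + i) %% m.
Proof.
move=> walk; elim=> [|i IH].
  by rewrite addn0 modn_small //; case/and4P: (walk 0).
case/and4P: (walk i) => _ _ /eqP-> _; rewrite IH.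
by rewrite (addnS _ i) -(addn1 (_ %% _)) modnDml addn1.
Qed.

Lemma gadget_cycle_dvd x y k : has_dcycle_len (gadget x y) k -> m %| k.
Proof.
case=> c [ck [k0 cyc]]; have c0 : 0 < size c by rewrite ck.
have [v _] : exists v : 'I_n, true by case: c c0 {ck cyc} => // v; exists v.
have := gadget_walk_phase (cycle_walk v cyc c0); rewrite ck => ph.
have := ph k; rewrite modnn mod0n => e.
have : phase (nth v c 0) + k = phase (nth v c 0) + 0 %[mod m].
  by rewrite -e addn0 [in RHS]e modn_mod.
by move/eqP; rewrite eqn_modDl mod0n.
Qed.

(* A closed walk that goes around once stays on one forward and one backward track, and its two turns exhibit a common element. *)
Lemma gadget_cycle_once x y :
  has_dcycle_len (gadget x y) m -> exists p, x p && y p.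
Proof.
case=> c [cm [m0 cyc]]; have c0 : 0 < size c by rewrite cm.
have [v _] : exists v : 'I_n, true by case: c c0 {cm cyc} => // v; exists v.
have walk := cycle_walk v cyc c0; rewrite cm in walk.
pose f i := nth v c (i %% m).
have ph := @gadget_walk_phase x y f walk.
have ph0m : phase (f 0) < m by case/and4P: (walk 0).
(* Rotate the closed walk so that it starts in phase 0. *)
pose g s := f (m - phase (f 0) + s).
have gph s : s < m -> phase (g s) = s.
  move=> sm; rewrite /g ph addnA subnKC ?(ltnW ph0m) //.
  by rewrite modnDl modn_small.
have gstep s : gadget x y (g s) (g s.+1) by rewrite /g (addnS _ s); exact: walk.
have gm : g m = g 0 by rewrite /g /f addn0 modnDr.
have forward s : s <= L -> track (g s) = track (g 0).
  elim: s => // s IH sL; rewrite -IH; last by lia.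
  have := gstep s; rewrite /gadget gph; last by lia.
  by rewrite !ifF; [case/and4P=> _ _ _ /eqP | lia | lia].
have backward s : L + 1 + s < m -> track (g (L + 1 + s)) = track (g (L + 1)).
  elim: s => [|s IH] sL; first by rewrite addn0.
  rewrite -IH; last by lia.
  have := gstep (L + 1 + s); rewrite /gadget gph; last by lia.
  by rewrite !ifF -?addnS; [case/and4P=> _ _ _ /eqP | lia | lia].
exists (track (g 0), track (g (L + 1))); apply/andP; split.
  have := gstep m.-1; rewrite /gadget gph; last by lia.
  rewrite ifF ?eqxx; last by lia.
  rewrite prednK ?gm; last by lia.
  have -> : m.-1 = L + 1 + L by lia.
  by rewrite backward; [case/and4P | lia].
have := gstep L; rewrite /gadget gph; last by lia.
by rewrite eqxx forward // -addn1 => /and4P[].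
Qed.

Lemma gadget_girth_intersecting x y p g :
  x p -> y p -> is_dgirth (gadget x y) g -> g = Some m.
Proof.
move=> xp yp; have mcyc := gadget_cycle xp yp.
case: g => [k [kcyc kmin]|/(_ m)//]; congr Some; apply/eqP.
rewrite eqn_leq kmin //= dvdn_leq ?(gadget_cycle_dvd kcyc) //.
by case: kcyc => c [_ []].
Qed.

Lemma gadget_girth_disjoint x y k :
  (forall p, ~~ (x p && y p)) -> is_dgirth (gadget x y) (Some k) -> 2 * m <= k.
Proof.
move=> dis [kcyc _]; have k0 : 0 < k by case: kcyc => c [_ []].
case/dvdnP: (gadget_cycle_dvd kcyc) => -[|[|a]] ek; first by rewrite ek in k0.
  rewrite ek mul1n in kcyc; have [p xyp] := gadget_cycle_once kcyc.
  by have := dis p; rewrite xyp.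
by rewrite ek leq_mul2r orbT.
Qed.

End GadgetGraph.

(** * From disjointness to the round lower bound *)

Section GirthLowerBound.
Local Open Scope nat_scope.

(** The answer [None] accepts, since disjoint inputs may leave the gadget acyclic. *)
Definition large_girth (T : nat) (out : option nat) : bool :=
  if out is Some k then 2 * (4 * T + 4) <= k else true.

Lemma gadget_correct_bound (R : realType) (eps : R) (n K q T : nat)
    (A : hybrid_alg n K) :
  (0 < eps)%R -> 0 < q -> q * (4 * T + 4) <= n -> correct eps A T ->
  q ^ 2 <= 1152 * (K * K.*2.+1 * (trunc_log 2 n).+1 ^ 2 * (T * (q * (4 * T + 4)))).+1.
Proof.
move=> eps0 q0 fits cor; set m := 4 * T + 4 in fits *.
pose d : drop_policy n := fun _ _ l => take (cap n K) l.
have d_ok : drop_ok K d.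
  by move=> r v l lt; rewrite /d take_subseq size_takel // ltnW.
have n0 : 0 < n by apply: leq_trans fits; rewrite /m; nia.
pose v0 : 'I_n := Ordinal n0.
have pos_v0 : position q T v0 < 2 * T + 1 - T.
  by rewrite /position /phase div0n ifT ?leq0n; lia.
have W0 : 0 < #|{ffun 'I_n -> Om A}| by rewrite card_ffun expn_gt0 Om_nonempty.
pose G := @gadget n q T q0.
pose acc (w : {ffun 'I_n -> Om A}) x y := accepts d G T (large_girth T) v0 w x y.
have success_disjoint (x y : {ffun 'I_q * 'I_q -> bool}) w : (forall p, ~~ (x p && y p)) ->
    success eps T (G x y) d w -> acc w x y.
  move=> dis [g [girth /(_ v0)]]; rewrite /acc /accepts; move: (output _ _ _) => out.
  case: g girth => [k|] girth; case: out => [k'|] //= -[kk' _].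
  by apply: leq_trans kk'; exact: gadget_girth_disjoint dis girth.
have success_intersecting (x y : {ffun 'I_q * 'I_q -> bool}) p w : x p -> y p ->
    success eps T (G x y) d w -> ~~ acc w x y.
  move=> xp yp [g [girth /(_ v0)]]; rewrite /acc /accepts; move: (output _ _ _) => out.
  rewrite (gadget_girth_intersecting fits xp yp girth); case: out => //= k [_].
  (* On intersecting inputs the answer is at most [(2 - eps) * m], strictly below the threshold
     [2 * m]. *)
  rewrite -/m -ltnNge -(ltr_nat R) natrM => /le_lt_trans; apply.
  by rewrite ltr_pM2r ?ltr0n; [lra | rewrite /m; lia].
pose E := busy n q T.
have card_le : #|transcript_type K T E| <=
    2 ^ (K * K.*2.+1 * (trunc_log 2 n).+1 ^ 2 * (T * (q * m))).+1.
  apply: leq_trans (card_transcript K T E) _; rewrite leq_exp2l // ltnS.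
  by rewrite !leq_mul // card_busy.
have -> : q ^ 2 = #|{: 'I_q * 'I_q}| by rewrite card_prod card_ord mulnn.
pose tau (w : {ffun 'I_n -> Om A}) x y := transcript d G T E (large_girth T) v0 w x y.
apply: (@disjointness_lower_bound R _ _ _ tau (fun t => t.2)) => //.
- move=> w x y x' y' t; apply: (@transcript_rectangle _ _ _ _ _ _ _ _ (2 * T + 1) (position q T)) => //.
  + by lia.
  + exact: gadget_left.
  + exact: gadget_right.
  + exact: position_adj.
  + exact: position_outside.
- move=> x y dis; apply: leq_trans (cor (G x y) (gadget_loopless T q0 x y) d d_ok) _.
  rewrite leq_mul2l /=; apply: subset_leq_card; apply/subsetP => w.
  by rewrite !inE => /asboolP /success_disjoint; apply.
- move=> x y p xp yp.
  have h := cor (G x y) (gadget_loopless T q0 x y) d d_ok.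
  have : [set w | `[< success eps T (G x y) d w >]] \subset ~: [set w | (tau w x y).2].
    apply/subsetP => w; rewrite !inE => /asboolP.
    exact: (@success_intersecting x y p w xp yp).
  move/subset_leq_card => sub.
  have {sub}h := leq_trans h (leq_mul (leqnn 3) sub).
  (* Successful seeds reject, so [2 * #|W|] is at most three times the number of rejecting seeds;
     accepting and rejecting seeds together number [#|W|], the number of all seeds. *)
  rewrite -(leq_add2r (2 * #|{ffun 'I_n -> Om A}|)).
  apply: leq_trans (leq_add (leqnn _) h) _.
  by rewrite -mulnDr cardsC.
Qed.

End GirthLowerBound.

(* Omega~(n^{1/3}): there are constants c, k, n0 (possibly depending on
   eps and on the O(log n) constant K of the model) such that for all
   n >= n0, every correct T-round algorithm has
   T >= n^{1/3} / (c * log^k n), i.e. n <= c * (T * log^k n)^3. *)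
Theorem theorem22 (R : realType) (eps : R) :
  0 < eps <= 1 ->
  forall K : nat,
  exists c k n0 : nat,
  forall n : nat, (n0 <= n)%N ->
  forall (T : nat) (A : hybrid_alg n K),
    correct eps A T ->
    (n <= c * (T * (trunc_log 2 n).+1 ^ k) ^ 3)%N.
Proof.
move=> /andP[eps0 _] K; set B := (K * K.*2.+1)%N.
(* The constant comes from [q <= 1153 * (8 * B + 1) * a] and [4 * T + 4 <= 8 * T] for positive [T].
   For [T = 0] one has [q = 1153], and the gadget needs [4 * 1153] nodes. *)
exists (8 * 1153 * (8 * B + 1))%N, 1%N, (4 * 1153)%N => n n_ge T A cor.
rewrite leqNgt expn1; apply/negP; set l := (trunc_log 2 n).+1 => n_gt.
pose a := (T ^ 2 * l ^ 2)%N.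
(* This is the least [q] above [1152 * (8 * B * a + 1)], so that [q ^ 2] exceeds the transcript
   bound [1152 * (8 * B * a * q + 1)]. *)
pose q := (1152 * (8 * B * a + 1)).+1.
have T_le : (T <= T ^ 2)%N by case: (T) => // t; rewrite -mulnn leq_pmulr.
have fits : (q * (4 * T + 4) <= n)%N.
  have [T0|T0] := posnP T.
    by move: n_ge; rewrite /q /a T0 /=; lia.
  apply: leq_trans (ltnW n_gt).
  have a0 : (0 < a)%N by rewrite muln_gt0 !expn_gt0 T0.
  have q_le : (q <= 1153 * (8 * B + 1) * a)%N by rewrite /q; nia.
  have aT : (a * T <= (T * l) ^ 3)%N.
    by rewrite /a expnMn mulnAC -expnSr leq_mul2l leq_pexp2l ?orbT.
  have T4 : (4 * T + 4 <= 8 * T)%N by lia.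
  apply: leq_trans (leq_mul q_le T4) _.
  have -> : (1153 * (8 * B + 1) * a * (8 * T) = 8 * 1153 * (8 * B + 1) * (a * T))%N by ring.
  by rewrite leq_mul2l aT orbT.
have := gadget_correct_bound eps0 (isT : (0 < q)%N) fits cor.
rewrite -/B -/l leqNgt => /negP; apply.
have : (T * (q * (4 * T + 4)) <= 8 * T ^ 2 * q)%N by nia.
move=> h; apply: (@leq_ltn_trans (1152 * (8 * B * a * q + 1))).
  rewrite leq_mul2l /= -addn1 leq_add2r.
  have -> : (8 * B * a * q = B * l ^ 2 * (8 * T ^ 2 * q))%N by rewrite /a; ring.
  by rewrite leq_mul2l h orbT.
rewrite -mulnn {2}/q; have : (0 < q)%N by []. nia.
Qed.
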